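(* Let $F$ be a precontinuous set functor with $F\emptyset\neq\emptyset$. Then the ideal completions of the posets $\mu F$ and $\nu F$ coincide. Moreover, the algebra structure $\iota\colon F(\mu F)\to\mu F$ of the initial algebra determines the coalgebra structure $\tau\colon\nu F\to F(\nu F)$ of the terminal coalgebra as the unique continuous extension of $\iota^{-1}$; that is, $\tau$ is the unique continuous map $\nu F\to F(\nu F)$ with $\tau\cdot m=Fm\cdot\iota^{-1}$.
   Context: A set functor is an endofunctor of $\mathbf{Set}$. A prelimit of an $\omega^{\mathrm{op}}$-chain is a collectively monic cone of it. A set functor is precontinuous if it takes every prelimit with nonempty domain of an $\omega^{\mathrm{op}}$-chain to a prelimit of the image chain. The initial-algebra chain of $F$ has objects $F^i0$ and connecting morphisms $w_{i,j}\colon F^i0\to F^j0$ ($i\leq j$): $F^00=0=\emptyset$, $F^{i+1}0=F(F^i0)$, $F^j0=\mathrm{colim}_{i<j}F^i0$ for limit ordinals $j$; $w_{0,1}\colon 0\to F0$ is unique, $w_{i+1,j+1}=Fw_{i,j}$, and for limit $j$ the $w_{i,j}$ ($i<j$) form the colimit cocone. The terminal-coalgebra chain has objects $F^i1$ and connecting morphisms $v_{i,j}\colon F^i1\to F^j1$ ($i\geq j$): $F^01=1$, $F^{i+1}1=F(F^i1)$, $F^j1=\lim_{i<j}F^i1$ for limit $j$; $v_{1,0}$ is unique, $v_{i+1,j+1}=Fv_{i,j}$, and for limit $j$ the $v_{j,i}$ ($i<j$) form the limit cone. There is a unique morphism $\bar u\colon F^\omega0\to F^\omega1$ with $v_{\omega,n}\cdot\bar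 u\cdot w_{n,\omega}=F^n!$ for all $n\in\mathbb{N}$, where $!\colon 0\to1$ is the unique map. For a precontinuous $F$, let $\delta$ be the smallest infinite ordinal at which the terminal-coalgebra chain converges, i.e., $v_{\delta+1,\delta}$ is invertible (such an ordinal exists); then $\nu F=F^\delta1$ with $\tau=v_{\delta+1,\delta}^{-1}$, and $v_{\delta,\omega}\colon\nu F\to F^\omega1$ is monic. The initial algebra $(\mu F,\iota)$ also exists, and $\mu F$ is regarded as a subset of $\nu F$ via the monomorphism $m\colon\mu F\to\nu F$ which is the unique coalgebra homomorphism from $(\mu F,\iota^{-1})$ to $(\nu F,\tau)$. Canonical partial orders: choose an element $p\colon1\to F\emptyset$. For $n\in\mathbb{N}$ put $e_n=\bar u\cdot w_{n+1,\omega}\cdot F^np\colon F^n1\to F^\omega1$ and $\varepsilon_n=e_n\cdot v_{\omega,n}\colon F^\omega1\to F^\omega1$. The partial order $\sqsubseteq$ on $F^\omega1$ is defined, for $t\neq s$, by $t\sqsubseteq s$ iff $t=\varepsilon_n(s)$ for some $n\in\mathbb{N}$. $\nu F$ is considered as a subposet of $F^\omega1$ via $v_{\delta,\omega}$ (thus for $t\neq s$ in $\nu F$ we have $t\sqsubseteq s$ iff $v_{\delta,\omega}(t)=\varepsilon_n(v_{\delta,\omega}(s))$ for some $n$), and $\mu F$ as a subposet of $\nu F$ via $m$. $F(\nu F)$ and $F(\mu F)$ carry the orders transported along the bijections $\tau$ and $\iota$. A cpo is a poset in which every directed subset has a join; continuous maps are those preserving directed joins. The ideal completion of a poset $P$ is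 a cpo $\bar P$ containing $P$ as a subposet such that for every monotone function $f\colon P\to Q$, where $Q$ is a cpo, there exists a unique continuous extension $\bar f\colon\bar P\to Q$.
   Formalization: In the ideal completion, only maps preserving existing directed joins (not all monotone maps) are extended, and the inclusion preserves those joins; with all monotone maps the claim fails for FX = X+1 (completions ω+1 and ω+2). *)

(* Defs.v *)
From Corelib Require Import Relation_Definitions.
From mathcomp Require Import all_boot.
From mathcomp Require Import boolp classical_sets.

Set Implicit Arguments.
Unset Strict Implicit.
Unset Printing Implicit Defensive.

Local Open Scope classical_set_scope.

(* One fixed universe of sets, so that functors on it can be iterated. *)
Definition Sets := Type.

Record set_functor := SetFunctor {
  fobj :> Sets -> Sets;
  fmap : forall X Y : Sets, (X -> Y) -> fobj X -> fobj Y;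
  fmap_id : forall X : Sets, fmap (@id X) =1 id;
  fmap_comp : forall (X Y Z : Sets) (g : Y -> Z) (f : X -> Y),
    fmap (g \o f) =1 fmap g \o fmap f
}.
Arguments fmap F {X Y} f x : rename.

(* An omega^op-chain is given by its objects [A n] and its successive
   connecting morphisms [a n]. *)
Definition cone (A : nat -> Sets) (a : forall n, A n.+1 -> A n)
    (X : Sets) (c : forall n, X -> A n) : Prop :=
  forall n, a n \o c n.+1 =1 c n.

Definition prelimit (A : nat -> Sets) (a : forall n, A n.+1 -> A n)
    (X : Sets) (c : forall n, X -> A n) : Prop :=
  cone a c /\
  forall (Y : Sets) (f g : Y -> X), (forall n, c n \o f =1 c n \o g) -> f =1 g.

Definition precontinuous (F : set_functor) : Prop :=
  forall (A : nat -> Sets) (a : forall n, A n.+1 -> A n)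
    (X : Sets) (c : forall n, X -> A n),
  inhabited X -> prelimit a c ->
  prelimit (fun n => fmap F (a n)) (fun n => fmap F (c n)).

(* A well-ordered type standing for an initial segment of the ordinals that is
   closed under successor and contains omega; every ordinal is an element of
   such a segment. *)
Record ordinals := Ordinals {
  ord :> Type;
  olt : ord -> ord -> Prop;
  olt_wf : well_founded olt;
  olt_trans : forall i j k, olt i j -> olt j k -> olt i k;
  olt_total : forall i j, olt i j \/ i = j \/ olt j i;
  ozero : ord;
  ozeroP : forall i, ~ olt i ozero;
  osucc : ord -> ord;
  osuccP : forall i j, olt i j <-> osucc i = j \/ olt (osucc i) j;
  oomega : ord;
  oomegaP : forall i, olt i oomega <-> exists n, i = iter n osucc ozero
}.
Arguments ozero {W} : rename.
Arguments oomega {W} : rename.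

Definition ole (W : ordinals) (i j : W) : Prop := i = j \/ olt i j.

Definition ofin (W : ordinals) (n : nat) : W := iter n (@osucc W) ozero.
Arguments ofin {W} n.

Definition olimit (W : ordinals) (j : W) : Prop :=
  j <> ozero /\ forall i, olt i j -> olt (osucc i) j.

Lemma ole_succ (W : ordinals) (i : W) : ole i (osucc i).
Proof. by right; apply/osuccP; left. Qed.

Lemma ole_fin_omega (W : ordinals) (n : nat) : ole (@ofin W n) oomega.
Proof. by right; apply/oomegaP; exists n. Qed.

(* F^i 1 and v_(i,j).  As limits are determined only up to isomorphism,
   F^(i+1) 1 = F (F^i 1) is given by a specified bijection [tsucc i]. *)
Record terminal_chain (F : set_functor) (W : ordinals) := TerminalChain {
  tobj :> W -> Sets;
  tmap : forall i j : W, ole j i -> tobj i -> tobj j;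
  tmap_id : forall i (h : ole i i), tmap h =1 id;
  tmap_comp : forall i j k (h : ole j i) (h' : ole k j) (h'' : ole k i),
    tmap h' \o tmap h =1 tmap h'';
  tobj_zero : forall Y : Sets, exists! f : Y -> tobj ozero, True;
  tsucc : forall i, F (tobj i) -> tobj (osucc i);
  tsuccV : forall i, tobj (osucc i) -> F (tobj i);
  tsuccK : forall i, cancel (@tsucc i) (@tsuccV i);
  tsuccVK : forall i, cancel (@tsuccV i) (@tsucc i);
  tmap_succ : forall i j (h : ole j i) (h' : ole (osucc j) (osucc i)),
    tmap h' \o @tsucc i =1 @tsucc j \o fmap F (tmap h);
  tobj_limit : forall j, olimit j ->
    forall (Y : Sets) (c : forall i, olt i j -> Y -> tobj i),
    (forall i k (hi : olt i j) (hk : olt k j) (h : ole k i),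
        tmap h \o c i hi =1 c k hk) ->
    exists! f : Y -> tobj j,
      forall i (hi : olt i j) (h : ole i j), tmap h \o f =1 c i hi
}.
Arguments tmap {F W} T {i j} h x : rename.
Arguments tsucc {F W} T i x : rename.
Arguments tsuccV {F W} T i x : rename.

(* v_(i+1,i) : F (F^i 1) -> F^i 1 *)
Definition tconn F W (T : terminal_chain F W) (i : W) : F (T i) -> T i :=
  tmap T (ole_succ i) \o tsucc T i.

(* v_(omega,n) *)
Definition tproj F W (T : terminal_chain F W) (n : nat) : T oomega -> T (ofin n) :=
  tmap T (ole_fin_omega W n).

(* delta is the least infinite ordinal with v_(delta+1,delta) invertible *)
Definition convergence_ordinal F W (T : terminal_chain F W) (delta : W) : Prop :=
  ole oomega delta /\ bijective (@tconn F W T delta) /\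
  forall i, ole oomega i -> olt i delta -> ~ bijective (@tconn F W T i).

Fixpoint iobj (F : set_functor) (n : nat) : Sets :=
  if n is n'.+1 then F (iobj F n') else void.

Fixpoint iconn (F : set_functor) (n : nat) : iobj F n -> iobj F n.+1 :=
  if n is n'.+1 then fmap F (@iconn F n') else of_void (F void).

(* the w n form the cocone w_(n,omega) presenting X as F^omega 0 *)
Definition initial_omega (F : set_functor) (X : Sets)
    (w : forall n, iobj F n -> X) : Prop :=
  (forall n, w n.+1 \o @iconn F n =1 w n) /\
  forall (Y : Sets) (c : forall n, iobj F n -> Y),
    (forall n, c n.+1 \o @iconn F n =1 c n) ->
    exists! f : X -> Y, forall n, f \o w n =1 c n.

(* F^n ! : F^n 0 -> F^n 1 *)
Fixpoint Fbang F W (T : terminal_chain F W) (n : nat) : iobj F n -> T (ofin n) :=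
  if n is n'.+1 then tsucc T (ofin n') \o fmap F (@Fbang F W T n')
  else of_void (T ozero).

(* F^n p : F^n 1 -> F^(n+1) 0, where p : 1 -> F 0 is given by its value *)
Fixpoint Fpoint F W (T : terminal_chain F W) (p : F void) (n : nat) :
    T (ofin n) -> iobj F n.+1 :=
  if n is n'.+1 then fmap F (@Fpoint F W T p n') \o tsuccV T (ofin n')
  else fun=> p.

Definition initial_algebra (F : set_functor) (A : Sets) (alg : F A -> A) : Prop :=
  forall (B : Sets) (beta : F B -> B),
    exists! h : A -> B, h \o alg =1 beta \o fmap F h.

Definition coalgebra_hom (F : set_functor) (A B : Sets)
    (alpha : A -> F A) (beta : B -> F B) (h : A -> B) : Prop :=
  beta \o h =1 fmap F h \o alpha.

Definition directed (P : Type) (le : relation P) (D : set P) : Prop :=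
  D !=set0 /\
  forall x y, D x -> D y -> exists z, D z /\ le x z /\ le y z.

Definition is_join (P : Type) (le : relation P) (D : set P) (s : P) : Prop :=
  (forall x, D x -> le x s) /\
  forall u, (forall x, D x -> le x u) -> le s u.

Definition cpo (P : Type) (le : relation P) : Prop :=
  Relation_Definitions.order P le /\ forall D, directed le D -> exists s, is_join le D s.

(* P need not be a cpo: the directed joins that exist in P are preserved.  For
   reflexive leP this entails monotonicity. *)
Definition continuous (P Q : Type) (leP : relation P) (leQ : relation Q)
    (f : P -> Q) : Prop :=
  forall (D : set P) (s : P),
    directed leP D -> is_join leP D s -> is_join leQ (f @` D) (f s).

(* Completions are taken among posets and maps preserving the existing directed
   joins: the inclusion j preserves those of P, and so do the maps f to be
   extended.  If all monotone f were allowed, every element of P would become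
   compact in C; then, for X |-> X + 1, the completions of mu F = omega and
   nu F = omega + 1 would be the non-isomorphic omega + 1 and omega + 2. *)
Definition ideal_completion (P C : Sets) (leP : relation P) (leC : relation C)
    (j : P -> C) : Prop :=
  [/\ Relation_Definitions.order P leP,
      cpo leC,
      forall x y, leP x y <-> leC (j x) (j y),
      continuous leP leC j
    & forall (Q : Sets) (leQ : relation Q), cpo leQ ->
        forall f : P -> Q, continuous leP leQ f ->
        exists! g : C -> Q, continuous leC leQ g /\ g \o j =1 f].

Section CanonicalOrder.
Variables (F : set_functor) (W : ordinals) (T : terminal_chain F W).
Variables (F0 : Sets) (w : forall n, iobj F n -> F0) (ubar : F0 -> T oomega).
Variable p : F void.

(* e_n : F^n 1 -> F^omega 1 *)
Definition trunc_emb (n : nat) : T (ofin n) -> T oomega :=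
  ubar \o w (n := n.+1) \o @Fpoint F W T p n.

(* epsilon_n *)
Definition trunc (n : nat) : T oomega -> T oomega :=
  @trunc_emb n \o @tproj F W T n.

Definition le_omega : relation (T oomega) :=
  fun t s => t = s \/ exists n, t = trunc n s.

End CanonicalOrder.

Definition pull_order (X Y : Type) (f : X -> Y) (le : relation Y) : relation X :=
  fun x y => le (f x) (f y).

(* Main.v *)
(** The common ideal completion is F^omega 1 itself.  The truncations satisfy
    eps_n eps_k = eps_min(n,k), they separate points, and compatible sequences
    of truncations have limits; this alone makes F^omega 1 a cpo in which every
    element is the directed join of its truncations.  Each truncation lies in
    the image of F^n 0 for some n, hence in mu F, so mu F and nu F are both
    dense subposets, and a continuous map on either extends by taking joins of
    its values on truncations.  The inclusion nu F -> F^omega 1 is injective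
    because precontinuity makes v_(omega+1,omega) injective, and this propagates
    along the chain.  The map mu F -> nu F is injective because mu F is reached
    by iterating F on subsets, and injectivity is preserved at each step.
    Finally, tau is an order isomorphism and, by density, a continuous map on
    nu F is determined by its restriction to mu F. *)
Require Import Defs.
From Corelib Require Import Relation_Definitions.
From mathcomp Require Import all_boot.
From mathcomp Require Import boolp classical_sets.

Set Implicit Arguments.
Unset Strict Implicit.
Unset Printing Implicit Defensive.

Local Open Scope classical_set_scope.

(** * Directed joins and continuous maps *)

Section Joins.
Variables (P : Type) (le : relation P).

Lemma is_join_unique D s s' : Relation_Definitions.antisymmetric P le ->
  is_join le D s -> is_join le D s' -> s = s'.
Proof. by move=> asym [us ls] [us' ls']; apply: asym; [apply: ls | apply: ls']. Qed.

Lemma chain_directed (f : nat -> P) :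
  (forall n k, n <= k -> le (f n) (f k)) -> directed le (range f).
Proof.
move=> f_le; split=> [|_ _ [n _ <-] [k _ <-]]; first by exists (f 0), 0.
exists (f (maxn n k)).
by split; [exists (maxn n k) | split; apply: f_le; rewrite ?leq_maxl ?leq_maxr].
Qed.

(** Continuity is tested on the directed set [[set x; y]], whose join is [y]. *)
Lemma continuous_mono (Q : Type) (leQ : relation Q) (f : P -> Q) :
  Relation_Definitions.reflexive P le -> continuous le leQ f ->
  forall x y, le x y -> leQ (f x) (f y).
Proof.
move=> refl f_cont x y xy.
have [] := f_cont [set x; y] y.
- split=> [|a b Da Db]; first by exists x; left.
  by exists y; split; [right | split; [case: Da => -> | case: Db => ->]].
- by split=> [a [] -> //|u ub]; apply: ub; right.
- by move=> ub _; apply: ub; exists x; first by left.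
Qed.
End Joins.

(** * Completeness and density for an abstract system of truncations *)

Section Truncations.
Variables (C : Sets) (eps : nat -> C -> C).
Hypothesis epsM : forall n k x, eps n (eps k x) = eps (minn n k) x.
Hypothesis eps_inj : forall x y, (forall n, eps n x = eps n y) -> x = y.
Hypothesis eps_lim : forall y : nat -> C,
  (forall n k, n <= k -> eps n (y k) = eps n (y n)) ->
  exists s, forall n, eps n s = eps n (y n).

Definition trunc_le : relation C := fun t s => t = s \/ exists n, t = eps n s.
Local Notation le := trunc_le.

Lemma epsl n k x : n <= k -> eps n (eps k x) = eps n x.
Proof. by rewrite epsM => /minn_idPl ->. Qed.

Lemma epsr n k x : k <= n -> eps n (eps k x) = eps k x.
Proof. by rewrite epsM => /minn_idPr ->. Qed.

Lemma eps_le n x : le (eps n x) x.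
Proof. by right; exists n. Qed.

Lemma eps_le_eps n k x : n <= k -> le (eps n x) (eps k x).
Proof. by move=> nk; right; exists n; rewrite epsl. Qed.

Lemma le_eps t s n : le t s -> exists k, eps n t = eps k s.
Proof. by case=> [->|[k ->]]; [exists n | exists (minn n k); rewrite epsM]. Qed.

Lemma trunc_order : Relation_Definitions.order C le.
Proof.
split=> [x|x y z|x y]; first by left.
- move=> [->//|[n ->]] yz; have [k ->] := le_eps n yz; exact: eps_le.
- case=> [//|[n xE]] [//|[k yE]].
  have [nk|/ltnW kn] := leqP n k.
    by rewrite [RHS]yE xE epsr.
  by rewrite [LHS]xE yE epsr.
Qed.
Let le_refl := ord_refl _ _ trunc_order.
Let le_trans := ord_trans _ _ trunc_order.
Let le_anti := ord_antisym _ _ trunc_order.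

(** This is convergence of [D], viewed as a net, in the topology induced by the truncations into
    discrete spaces. *)
Definition eps_converges (D : set C) (s : C) : Prop :=
  forall n, exists2 x, D x & forall z, D z -> le x z -> eps n z = eps n s.

Lemma eps_converges_join D s :
  directed le D -> eps_converges D s -> is_join le D s.
Proof.
move=> [_ Ddir] Ds; split=> [x Dx|u ub].
- have [[k xk]|xinf] := pselect (exists k, x = eps k x).
    have [y Dy ys] := Ds k; have [z [Dz [xz yz]]] := Ddir _ _ Dx Dy.
    have zs := ys _ Dz yz.
    case: xz => [xz|[l xl]]; first by rewrite xk xz zs; apply: eps_le.
    have [lk|/ltnW kl] := leqP l k.
      by rewrite xl -(epsl _ lk) zs epsl //; apply: eps_le.
    by rewrite xk xl epsl // zs; apply: eps_le.
  (* An [x] fixed by no truncation is maximal, so it equals every member of [D] above it. *)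
  left; apply: eps_inj => n.
  have [y Dy ys] := Ds n; have [z [Dz [xz yz]]] := Ddir _ _ Dx Dy.
  rewrite -(ys _ Dz yz); case: xz => [->//|[k xk]].
  by case: xinf; exists k; rewrite xk epsr.
- have [su|] := pselect (forall n, eps n s = eps n u).
    by left; apply: eps_inj.
  (* If [s] and [u] differ at level [n], the members of [D] above [x] must be truncations of [u] at
     levels at most [n]. They all equal [eps n s], so [D] is constant from [x] on and [s] is [x]. *)
  move=> /existsNP[n su]; have [x Dx xs] := Ds n.
  have const z : D z -> le x z -> z = eps n s.
    move=> Dz xz; have zs := xs _ Dz xz; rewrite -zs.
    case: (ub _ Dz) => [zu|[l zl]]; first by case: su; rewrite -zs zu.
    have [nl|/ltnW ln] := leqP n l; last by rewrite zl epsr.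
    by case: su; rewrite -zs zl epsl.
  suff -> : s = x by apply: ub.
  rewrite (const _ Dx (le_refl x)); apply: eps_inj => j.
  have [y Dy ys] := Ds j; have [z [Dz [xz yz]]] := Ddir _ _ Dx Dy.
  by rewrite -(const _ Dz xz) (ys _ Dz yz).
Qed.

(** Once level [n] is stable beyond [x], level [n.+1] changes at most once: a [z] where it changes
    cannot be [eps k z'] with [k <= n], since it would then lie below [x]. *)
Lemma directed_stabilizes D n : directed le D ->
  exists2 x, D x & forall z, D z -> le x z -> eps n z = eps n x.
Proof.
move=> [[x0 Dx0] _]; elim: n => [|n [x Dx xn]].
  by exists x0 => // z _ [->//|[k ->]]; rewrite epsl.
have [xs|] := pselect (forall z, D z -> le x z -> eps n.+1 z = eps n.+1 x).
  by exists x.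
move=> /existsNP[z /not_implyP[Dz /not_implyP[xz xzn]]].
exists z => // z' Dz' zz'; have xz' := le_trans xz zz'.
case: zz' => [->//|[k zk]].
have [nk|kn] := ltnP n k; first by rewrite zk epsl.
case: xzn; congr (eps n.+1 _); apply: le_anti => //.
by rewrite zk -(epsl _ kn) xn // epsl //; apply: eps_le.
Qed.

Lemma directed_eps_converges D : directed le D -> exists s, eps_converges D s.
Proof.
move=> Ddir.
have /choice[x xP] : forall n, exists x,
    D x /\ forall z, D z -> le x z -> eps n z = eps n x.
  by move=> n; have [x] := directed_stabilizes n Ddir; exists x.
have [|s sx] := @eps_lim x.
  move=> n k nk.
  have [z [Dz [xnz xkz]]] := Ddir.2 _ _ (xP n).1 (xP k).1.
  by rewrite -(epsl _ nk) -((xP k).2 z) // epsl // ((xP n).2 z).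
by exists s => n; exists (x n); [case: (xP n) | rewrite sx; case: (xP n)].
Qed.

Lemma join_eps_converges D s :
  directed le D -> is_join le D s -> eps_converges D s.
Proof.
move=> Ddir Ds; have [s' Ds'] := directed_eps_converges Ddir.
by rewrite (is_join_unique le_anti Ds (eps_converges_join Ddir Ds')).
Qed.

Lemma trunc_cpo : cpo le.
Proof.
split=> [|D Ddir]; first exact: trunc_order.
have [s Ds] := directed_eps_converges Ddir.
by exists s; apply: eps_converges_join.
Qed.

Lemma eps_directed c : directed le (range (eps^~ c)).
Proof. by apply: chain_directed => n k; apply: eps_le_eps. Qed.

Lemma eps_join c : is_join le (range (eps^~ c)) c.
Proof.
apply: eps_converges_join (eps_directed c) _ => n.
exists (eps n c) => [|_ [k _ <-]]; first by exists n.
move=> nk; have [/epsl -> //|/ltnW kn] := leqP n k.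
by rewrite (le_anti (eps_le_eps c kn) nk) epsl.
Qed.

Section Completion.
Variables (P : Sets) (j : P -> C).
Hypothesis j_inj : injective j.
Hypothesis j_dense : forall n c, exists a, j a = eps n c.
Local Notation leP := (pull_order j le).

Let approx n c : P := projT1 (cid (j_dense n c)).

Let j_approx n c : j (approx n c) = eps n c.
Proof. by rewrite /approx; case: cid. Qed.

Lemma pull_trunc_order : Relation_Definitions.order P leP.
Proof.
split=> [x|x y z|x y]; [exact: le_refl|exact: le_trans|].
by move=> xy yx; apply: j_inj; apply: le_anti.
Qed.

Lemma pull_directed D : directed leP D -> directed le (j @` D).
Proof.
move=> [[x Dx] Ddir]; split=> [|_ _ [a Da <-] [b Db <-]]; first by exists (j x), x.
by have [z [Dz ?]] := Ddir _ _ Da Db; exists (j z); split; [exists z|].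
Qed.

(** A join in [C] strictly below [j s] would be a truncation of [j s], hence by density an upper
    bound already present in [P]. *)
Lemma pull_continuous : continuous leP le j.
Proof.
move=> D s Ddir [ub lub].
have jDdir := pull_directed Ddir; have [s' Ds'] := trunc_cpo.2 _ jDdir.
suff -> : j s = s' by [].
have s's : le s' (j s) by apply: Ds'.2 => _ [a Da <-]; apply: ub.
apply: le_anti => //; case: (s's) => [->//|[n s'n]].
have [a ja] := j_dense n (j s).
rewrite s'n -ja; apply: lub => b Db; rewrite /pull_order ja -s'n.
by apply: Ds'.1; exists b.
Qed.

Lemma approx_le n k c : n <= k -> leP (approx n c) (approx k c).
Proof. by rewrite /pull_order !j_approx; apply: eps_le_eps. Qed.

Lemma pull_approx_join c x :
  j x = c -> is_join leP (range (approx^~ c)) x.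
Proof.
move=> <-; split=> [_ [n _ <-]|u ub].
  by rewrite /pull_order j_approx; apply: eps_le.
apply: (eps_join (j x)).2 => _ [n _ <-].
by rewrite -j_approx; apply: ub; exists n.
Qed.

Section Extension.
Variables (Q : Sets) (leQ : relation Q) (f : P -> Q).
Hypotheses (Qcpo : cpo leQ) (f_cont : continuous leP leQ f).

Let f_mono : forall x y, leP x y -> leQ (f x) (f y).
Proof. exact: continuous_mono (ord_refl _ _ pull_trunc_order) f_cont. Qed.

Let ext_ex c : exists q, is_join leQ (range (fun n => f (approx n c))) q.
Proof.
by apply: Qcpo.2; apply: chain_directed => n k nk; apply: f_mono; apply: approx_le.
Qed.

Let ext c : Q := projT1 (cid (ext_ex c)).

Let ext_join c : is_join leQ (range (fun n => f (approx n c))) (ext c).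
Proof. by rewrite /ext; case: cid. Qed.

Let f_approx_ext n c : leQ (f (approx n c)) (ext c).
Proof. by apply: (ext_join c).1; exists n. Qed.

Let ext_mono c c' : le c c' -> leQ (ext c) (ext c').
Proof.
move=> cc'; apply: (ext_join c).2 => _ [n _ <-].
have [k nk] := le_eps n cc'.
suff -> : approx n c = approx k c' by [].
by apply: j_inj; rewrite !j_approx.
Qed.

(** Each truncation of a directed join is already a truncation of some member of [D]. *)
Let ext_cont : continuous le leQ ext.
Proof.
move=> D s Ddir Ds; split=> [_ [c Dc <-]|u ub].
  by apply: ext_mono; apply: Ds.1.
apply: (ext_join s).2 => _ [n _ <-].
have [x Dx xs] := join_eps_converges Ddir Ds n.
have -> : approx n s = approx n x.
  by apply: j_inj; rewrite !j_approx (xs x).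
apply: (ord_trans _ _ Qcpo.1) (f_approx_ext n x) _.
by apply: ub; exists x.
Qed.

Let extE x : ext (j x) = f x.
Proof.
apply: is_join_unique (ord_antisym _ _ Qcpo.1) (ext_join _) _.
rewrite -(image_comp (approx^~ (j x)) f); apply: f_cont.
  by apply: chain_directed => n k; apply: approx_le.
exact: pull_approx_join.
Qed.

Let ext_unique g : continuous le leQ g -> g \o j =1 f -> ext = g.
Proof.
move=> g_cont gj; apply/funext => c.
apply: is_join_unique (ord_antisym _ _ Qcpo.1) (ext_join c) _.
have -> : range (fun n => f (approx n c)) = g @` range (eps^~ c).
  rewrite image_comp; congr (_ @` _); apply/funext => n /=.
  by rewrite -j_approx -gj.
by apply: g_cont; [apply: eps_directed | apply: eps_join].
Qed.

Lemma trunc_extension : exists! g : C -> Q, continuous le leQ g /\ g \o j =1 f.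
Proof.
exists ext; split=> [|g [g_cont gj]]; last exact: ext_unique.
by split; [exact: ext_cont | exact: extE].
Qed.
End Extension.

Lemma trunc_completion : ideal_completion leP le j.
Proof.
split=> //; [exact: pull_trunc_order|exact: trunc_cpo|exact: pull_continuous|].
by move=> Q leQ Qcpo f f_cont; apply: trunc_extension.
Qed.

(** The approximations of any point lie in the image of [i], so [f] and [g] agree on a directed set
    whose join is that point. *)
Lemma dense_continuous_eq (M Q : Type) (i : M -> P) (leQ : relation Q)
    (f g : P -> Q) : (forall n c, exists a, j (i a) = eps n c) ->
  Relation_Definitions.antisymmetric Q leQ ->
  continuous leP leQ f -> continuous leP leQ g -> f \o i =1 g \o i -> f = g.
Proof.
move=> i_dense asym f_cont g_cont fg; apply/funext => x.
have dir : directed leP (range (approx^~ (j x))).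
  by apply: chain_directed => n k; apply: approx_le.
have join := pull_approx_join (erefl (j x)).
apply: is_join_unique asym (f_cont _ _ dir join) _.
suff -> : f @` range (approx^~ (j x)) = g @` range (approx^~ (j x)).
  exact: g_cont.
rewrite !image_comp; congr (_ @` _); apply/funext => n /=.
have [a ja] := i_dense n (j x).
have -> : approx n (j x) = i a by apply: j_inj; rewrite j_approx.
exact: fg.
Qed.
End Completion.
End Truncations.

(* A transfinite iteration of [phi] along inclusions, without ordinals. *)
Section Tower.
Variables (A : Type) (phi : set A -> set A).
Hypothesis phi_mono : forall S S', S `<=` S' -> phi S `<=` phi S'.

(** An empty [G] yields the starting set. Arbitrary families are allowed, since comparability is
    proved afterwards. *)
Inductive tower : set A -> Prop :=
| tower_step S : tower S -> tower (phi S)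
| tower_cup (G : set (set A)) :
    (forall S, G S -> tower S) -> tower (\bigcup_(S in G) S).

Lemma tower_infl S : tower S -> S `<=` phi S.
Proof.
elim=> {S} [S _|G _ IH]; first exact: phi_mono.
by move=> x [S GS /(IH _ GS)]; apply: phi_mono => y Sy; exists S.
Qed.

(* The Bourbaki-Witt argument: [E] is extreme if [phi S] lies below [E] for each
   [S] in the tower strictly below [E]. *)
Let extreme E := forall S, tower S -> S `<=` E -> S <> E -> phi S `<=` E.

Let extreme_dichotomy E S : extreme E -> tower S -> S `<=` E \/ phi E `<=` S.
Proof.
move=> Eext; elim=> {S} [S towS [SE|ES]|G towG IH].
- have [->|SnE] := pselect (S = E); first by right.
  by left; apply: Eext.
- by right; apply: subset_trans ES _; apply: tower_infl.
- have [[S [GS ES]]|nE] := pselect (exists S, G S /\ phi E `<=` S).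
    by right=> x /ES Sx; exists S.
  left=> x [S GS]; case: (IH _ GS) => [|ES]; first exact.
  by case: nE; exists S.
Qed.

Let tower_extreme E : tower E -> extreme E.
Proof.
elim=> {E} [E towE Eext|G towG IH] S towS SE SnE.
  have [|ES] := extreme_dichotomy Eext towS; first exact: phi_mono.
  by case: SnE; rewrite eqEsubset.
have [GS|] := pselect (forall E, G E -> phi E `<=` S).
  case: SnE; rewrite eqEsubset; split=> // x [E GE Ex].
  by apply: (GS _ GE); apply: tower_infl Ex; apply: towG.
move=> /existsNP[E /not_implyP[GE ES]].
have [SsubE|//] := extreme_dichotomy (IH _ GE) towS.
have EG : E `<=` \bigcup_(E in G) E by move=> x Ex; exists E.
(* The induction hypothesis says nothing when [S] is [E]; comparing the whole union with [E] settles
   that case. *)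
have [SE'|SnE'] := pselect (S = E); last first.
  by apply: subset_trans EG; apply: IH.
have [GsubE|] := extreme_dichotomy (IH _ GE) (tower_cup towG).
  by case: SnE; rewrite eqEsubset; split=> //; rewrite SE'.
by rewrite SE'.
Qed.

Lemma tower_total S S' : tower S -> tower S' -> S `<=` S' \/ S' `<=` S.
Proof.
move=> towS towS'.
have [|S'S] := extreme_dichotomy (tower_extreme towS') towS; first by left.
by right; apply: subset_trans S'S; apply: tower_infl.
Qed.
End Tower.

(** * Set functors on injections, and injective homomorphisms out of initial algebras *)

Section SetFunctor.
Variable F : set_functor.

Lemma fmapD (X Y Z : Sets) (g : Y -> Z) (f : X -> Y) x :
  fmap F (g \o f) x = fmap F g (fmap F f x).
Proof. exact: fmap_comp. Qed.

Lemma eq_fmap (X Y : Sets) (f g : X -> Y) : f =1 g -> fmap F f =1 fmap F g.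
Proof. by move=> /funext ->. Qed.

(** The default value [x0] is taken off the image of [S], so [S] itself may be empty. *)
Lemma inj_retraction (X Y : Sets) (S : set X) (h : X -> Y) (x0 : X) :
  (forall x y, S x -> S y -> h x = h y -> x = y) ->
  exists r : Y -> X, forall x, S x -> r (h x) = x.
Proof.
move=> h_inj.
have /choice[r rP] : forall y, exists x, forall x', S x' -> h x' = y -> x = x'.
  move=> y; have [[x [Sx hx]]|nx] := pselect (exists x, S x /\ h x = y).
    by exists x => x' Sx' hx'; apply: h_inj; rewrite // hx.
  by exists x0 => x' Sx' hx'; case: nx; exists x'.
by exists r => x Sx; apply: rP.
Qed.

(** An injection with nonempty domain is split, and functors preserve split injections. *)
Lemma fmap_inj (X Y : Sets) (h : X -> Y) :
  inhabited X -> injective h -> injective (fmap F h).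
Proof.
move=> [x0] h_inj; have [|r rP] := @inj_retraction X Y setT h x0.
  by move=> x y _ _; apply: h_inj.
apply: (can_inj (g := fmap F r)) => u.
rewrite -fmapD -[RHS](@fmap_id F); apply: eq_fmap => x; exact: rP.
Qed.

Section InitialAlgebra.
Variables (A B : Sets) (alg : F A -> A) (beta : F B -> B) (h : A -> B).
Hypotheses (algP : initial_algebra alg) (beta_inj : injective beta).
Hypothesis hP : h \o alg =1 beta \o fmap F h.

Let phi (S : set A) : set A :=
  [set alg (fmap F (@proj1_sig A S) u) | u in [set: F {x | S x}]].

Let phi_mono S S' : S `<=` S' -> phi S `<=` phi S'.
Proof.
move=> SS' _ [u _ <-].
pose i (x : {x | S x}) : {x | S' x} := exist _ (sval x) (SS' _ (svalP x)).
by exists (fmap F i u) => //; rewrite -fmapD.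
Qed.

(** The hypothesis makes [S] a subalgebra; the homomorphism into it, followed by the inclusion, is
    an endomorphism of the initial algebra, hence the identity. *)
Lemma initial_algebra_ind (S : set A) : phi S `<=` S -> forall x, S x.
Proof.
move=> phiS.
pose algS (u : F {x | S x}) : {x | S x} :=
  exist _ _ (phiS _ (imageT (fun u => alg (fmap F sval u)) u)).
have [g [gP _]] := algP algS; have [k [kP k_uniq]] := algP alg.
have kE : k = id by apply: k_uniq => x /=; rewrite fmap_id.
have kE' : k = sval \o g.
  apply: k_uniq => x /=; have /= -> := gP x; by rewrite /= fmapD.
move=> x; have -> : x = sval (g x) by rewrite -[LHS]/(id x) -kE kE'.
exact: svalP.
Qed.

(* [A] is the largest member of the tower generated by [phi], and [h] is
   injective on every member. *)
Lemma initial_algebra_hom_inj : injective h.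
Proof.
have tower_inj S : tower phi S ->
    forall x y, S x -> S y -> h x = h y -> x = y.
  elim=> {S} [S towS IH _ _ [u _ <-] [v _ <-]|G towG IH x y [S GS Sx] [S' GS' Sy]].
    have /= hE z := hP z; rewrite !hE => /beta_inj uv; congr alg.
    (* A left inverse landing in all of [A] lets [F] cancel [h] even for empty [S], where [F] need
       not preserve injectivity. *)
    have [r rP] := inj_retraction (alg (fmap F sval u)) IH.
    have rhE z : fmap F (@proj1_sig A S) z = fmap F r (fmap F h (fmap F sval z)).
      by rewrite -2!fmapD; apply: eq_fmap => a /=; rewrite rP //; apply: svalP.
    by rewrite rhE uv -rhE.
  have [SS'|S'S] := tower_total phi_mono (towG _ GS) (towG _ GS').
    by apply: (IH _ GS') => //; apply: SS'.
  by apply: (IH _ GS) => //; apply: S'S.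
(* The union of all members is itself a member, hence closed under [phi], so induction makes it all
   of [A]. *)
have towU := tower_cup (phi := phi) (G := tower phi) (fun S => id).
have allU : forall x, (\bigcup_(S in tower phi) S) x.
  apply: initial_algebra_ind => x Ux.
  by exists (phi (\bigcup_(S in tower phi) S)); first exact: tower_step.
by move=> x y; apply: tower_inj towU _ _ _ _; apply: allU.
Qed.
End InitialAlgebra.
End SetFunctor.

(** * Order facts for the ordinal segment *)

Section Ordinals.
Variable W : ordinals.

Lemma olt_irr (i : W) : ~ olt i i.
Proof.
by elim/(well_founded_ind (@olt_wf W)): i => i IH i_lt; exact: (IH i i_lt i_lt).
Qed.

Lemma ofin_omega n : olt (@ofin W n) oomega.
Proof. by apply/oomegaP; exists n. Qed.

Lemma ofin_lt k n : k < n -> olt (@ofin W k) (ofin n).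
Proof.
elim: n => // n IH; rewrite ltnS leq_eqVlt => /orP[/eqP->|/IH kn].
  by apply/osuccP; left.
by apply: olt_trans kn _; apply/osuccP; left.
Qed.

Lemma ole_fin k n : ole (@ofin W k) (ofin n) -> k <= n.
Proof.
move=> kn; rewrite leqNgt; apply/negP => /ofin_lt nk.
by case: kn => [kn|/(olt_trans nk)]; [move: nk; rewrite kn|]; apply: olt_irr.
Qed.

Lemma ole_trans (i j k : W) : ole i j -> ole j k -> ole i k.
Proof.
move=> [->//|ij] [<-|jk]; right=> //; exact: olt_trans jk.
Qed.

Lemma ole_succ2 (i j : W) : ole i j -> ole (osucc i) (osucc j).
Proof.
move=> [->|ij]; first by left.
by have /osuccP ij' := ij; apply: ole_trans ij' (ole_succ _).
Qed.

Lemma ole_lt_succ (i j : W) : olt i (osucc j) -> ole i j.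
Proof.
move=> isj; have [ij|[->|/osuccP ji]] := olt_total i j; [by right|by left|].
case: ji => [ji|/(olt_trans isj)]; last by move/olt_irr.
by move: isj; rewrite ji => /olt_irr.
Qed.

Lemma olimit_omega : olimit (@oomega W).
Proof.
split=> [w0|_ /oomegaP[n ->]]; last exact: (ofin_omega n.+1).
by have := ofin_omega 0; rewrite w0 => /ozeroP.
Qed.

Lemma ord_cases (i : W) : [\/ i = ozero, exists j, i = osucc j | olimit i].
Proof.
have [->|i0] := pselect (i = ozero); first by constructor 1.
have [[j ->]|nj] := pselect (exists j, i = osucc j).
  by constructor 2; exists j.
by constructor 3; split=> // j /osuccP[ji|//]; case: nj; exists j.
Qed.
End Ordinals.

(** * Limits and injectivity along the terminal-coalgebra chain *)

Section TerminalChain.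
Variables (F : set_functor) (W : ordinals) (T : terminal_chain F W).
Local Notation proj := (@tproj F W T).

Lemma tmapD i j k (h : ole j i) (h' : ole k j) (h'' : ole k i) x :
  tmap T h' (tmap T h x) = tmap T h'' x.
Proof. exact: tmap_comp. Qed.

Lemma limit_separated j : olimit j -> forall x y : T j,
  (forall i (hi : olt i j), tmap T (or_intror hi) x = tmap T (or_intror hi) y) ->
  x = y.
Proof.
move=> jlim x y xy.
have [|f [_ f_uniq]] :=
    @tobj_limit _ _ T j jlim unit (fun i hi _ => tmap T (or_intror hi) x).
  by move=> i k hi hk h u /=; rewrite (tmapD _ _ (or_intror hk)).
have fE z : (forall i (hi : olt i j),
    tmap T (or_intror hi) z = tmap T (or_intror hi) x) -> f = fun=> z.
  move=> zx; apply: f_uniq => i hi h u /=.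
  by rewrite (Prop_irrelevance h (or_intror hi)).
have fx : f = fun=> x by apply: fE.
have fy : f = fun=> y by apply: fE => i hi; rewrite xy.
by have /(congr1 (@^~ tt)) := etrans (esym fx) fy.
Qed.

Lemma ozero_eq (x y : T ozero) : x = y.
Proof.
have [f [_ f_uniq]] := @tobj_zero _ _ T unit.
have fE z : f = fun=> z by apply: f_uniq.
by have /(congr1 (@^~ tt)) := etrans (esym (fE x)) (fE y).
Qed.

Lemma tproj_succ n x :
  tmap T (ole_succ (ofin n)) (proj n.+1 x) = proj n x.
Proof. exact: tmapD. Qed.

Lemma tproj_eq n k x y : k <= n -> proj n x = proj n y ->
  proj k x = proj k y.
Proof.
elim: n => [|n IH]; first by rewrite leqn0 => /eqP->.
rewrite leq_eqVlt => /orP[/eqP->//|kn] xy; apply: IH => //.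
by rewrite -[LHS]tproj_succ -[RHS]tproj_succ xy.
Qed.

Lemma tproj_inj x y : (forall n, proj n x = proj n y) -> x = y.
Proof.
move=> xy; apply: (limit_separated (@olimit_omega W)) => i hi.
have /oomegaP[n iE] := hi; move: hi; rewrite iE => hi.
rewrite (Prop_irrelevance (or_intror hi) (ole_fin_omega W n)); exact: xy.
Qed.

Lemma tproj_lim (y : nat -> T oomega) :
  (forall n k, n <= k -> proj n (y k) = proj n (y n)) ->
  exists s, forall n, proj n s = proj n (y n).
Proof.
move=> y_comp.
(* The limit is indexed by elements of [W]; [N] recovers the number of a finite ordinal, with
   default 0 elsewhere. *)
have /choice[N NP] : forall i : W, exists n, olt i oomega -> i = ofin n.
  move=> i; have [/oomegaP[n ->]|ni] := pselect (olt i oomega); first by exists n.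
  by exists 0.
have [|f [fP _]] := @tobj_limit _ _ T _ (@olimit_omega W) unit
    (fun i hi _ => tmap T (or_intror hi) (y (N i))).
  move=> i k hi hk h _ /=; rewrite (tmapD _ _ (or_intror hk)).
  have : N k <= N i by apply: (@ole_fin W); rewrite -!NP.
  move: (or_intror hk) => {h} h; move: (N k) (NP k hk) h => a ->.
  by move=> h /y_comp; rewrite /tproj (Prop_irrelevance (ole_fin_omega W a) h).
exists (f tt) => n.
have /= fE := fP _ (ofin_omega W n) (ole_fin_omega W n) tt.
rewrite /tproj fE.
have : N (ofin n) = n.
  by apply/eqP; rewrite eqn_leq; apply/andP; split; apply: (@ole_fin W);
    rewrite -NP; [left|exact: ofin_omega|left|exact: ofin_omega].
by move=> ->; congr (tmap T _ _); apply: Prop_irrelevance.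
Qed.

Hypothesis F_precont : precontinuous F.

(** $v_{i+1,\omega}$ is $F v_{i,\omega}$ followed by $v_{\omega+1,\omega}$. The latter is injective
    because precontinuity keeps the limit cone of $F^\omega 1$ collectively monic. *)
Lemma tmap_inj_succ i (h : ole oomega i) (h' : ole oomega (osucc i)) :
  inhabited (T i) -> injective (tmap T h) -> injective (tmap T h').
Proof.
move=> [t0] h_inj.
have pre : prelimit (fun n => tmap T (ole_succ (ofin n))) proj.
  split=> [n x|Y f g fg x]; first exact: tproj_succ.
  by apply: tproj_inj => n; apply: fg.
have [_ Fpre] := F_precont (inhabits (tmap T h t0)) pre.
have sw_inj : injective (tmap T (ole_succ (@oomega W))).
  move=> x y xy; apply: (can_inj (@tsuccVK _ _ T _)).
  suff V_eq : (fun=> tsuccV T _ x) =1 (fun _ : unit => tsuccV T _ y).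
    exact: V_eq tt.
  apply: Fpre => n _ /=; apply: (can_inj (@tsuccK _ _ T _)).
  have hs : ole (osucc (ofin n)) (osucc (@oomega W)).
    exact: ole_succ2 (ole_fin_omega W n).
  have /= sE z := tmap_succ (ole_fin_omega W n) hs z.
  rewrite /tproj -!sE !tsuccVK.
  by rewrite -2!(tmapD (ole_succ _) (ole_fin_omega W n.+1)) xy.
move=> x y.
have hs := ole_succ2 h.
rewrite -2!(tmapD hs (ole_succ _)) => /sw_inj.
have /= sE z := tmap_succ h hs z.
rewrite -[x]tsuccVK -[y]tsuccVK !sE => sxy.
congr (tsucc T _ _); apply: fmap_inj h_inj _ _ _; first exact: (inhabits t0).
exact: (can_inj (@tsuccK _ _ T _)).
Qed.

(** In this transfinite induction, a point of [T i] projects to every earlier stage, so the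
    induction hypothesis applies there; at limits the projections are jointly injective. *)
Lemma tmap_inj i (h : ole oomega i) : inhabited (T i) -> injective (tmap T h).
Proof.
elim/(well_founded_ind (@olt_wf W)): i h => i IH h [t0].
have tmap0 k (hk : ole k i) : inhabited (T k) by exact: inhabits (tmap T hk t0).
have [wi|wi] := h.
  by move: h => {IH t0 tmap0}; rewrite -wi => h x y; rewrite !tmap_id.
have [i0|[k ik]|ilim] := ord_cases i.
- by case: (@ozeroP W oomega); rewrite -i0.
- move: i ik wi h IH t0 tmap0 => _ -> wi h IH t0 tmap0.
  have wk := ole_lt_succ wi; apply: (tmap_inj_succ (h := wk)).
    exact: tmap0 (ole_succ k).
  by apply: IH; [apply/osuccP; left | apply: tmap0 (ole_succ k)].
- move=> x y xy; apply: (limit_separated ilim) => k hk.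
  have [kw|wk] : ole k oomega \/ olt oomega k.
    by have [kw|[kw|]] := olt_total k oomega; [left; right|left; left|right].
    by rewrite -2!(tmapD h kw) xy.
  apply: (IH k hk (or_intror wk)); first exact: tmap0 (or_intror hk).
  by rewrite !(tmapD _ _ h).
Qed.
End TerminalChain.

(** * The concrete truncations of $F^\omega 1$ and the density of $\mu F$ *)

Section CanonicalOrder.
Variables (F : set_functor) (W : ordinals) (T : terminal_chain F W).
Variables (F0 : Sets) (w : forall n, iobj F n -> F0).
Hypothesis w_cocone : forall n, @w n.+1 \o @iconn F n =1 @w n.
Variable ubar : F0 -> T oomega.
Hypothesis ubarP : forall n, @tproj F W T n \o ubar \o @w n =1 @Fbang F W T n.
Variable p : F void.
Local Notation proj := (@tproj F W T).
Local Notation bang n := (@Fbang F W T n).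
Local Notation point n := (@Fpoint F W T p n).
Local Notation eps := (trunc (@w) ubar p).

(** This is $F^n$ applied to the identity of $1$, factored as $1 \to F0 \to F1 \to 1$. *)
Lemma Fpoint_section n x :
  tmap T (ole_succ (ofin n)) (bang n.+1 (point n x)) = x.
Proof.
elim: n x => [|n IH] x; first exact: ozero_eq.
have /= sE z := tmap_succ (ole_succ (@ofin W n)) (ole_succ (@ofin W n.+1)) z.
rewrite /= sE -[RHS]tsuccVK; congr (tsucc T _ _).
rewrite -2!fmapD -[RHS](@fmap_id F); apply: eq_fmap => y; exact: IH.
Qed.

(** This is $F^n$ applied to the unique map $0 \to F0$, factored through $1$. *)
Lemma Fpoint_bang n x : point n (bang n x) = iconn x.
Proof.
elim: n x => [[]|n IH] x /=.
by rewrite tsuccK -fmapD; apply: eq_fmap => y; apply: IH.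
Qed.

Lemma proj_ubar n x : proj n (ubar (@w n x)) = bang n x.
Proof. exact: ubarP. Qed.

Lemma proj_trunc n x : proj n (eps n x) = proj n x.
Proof. by rewrite -tproj_succ [proj n.+1 _]proj_ubar Fpoint_section. Qed.

Lemma trunc_proj n x y : proj n x = proj n y -> eps n x = eps n y.
Proof. by rewrite /trunc /= => ->. Qed.

(** Quantifying over all cocones lets one lift serve both [w] and [mu_cocone]. *)
Lemma iobj_lift n k (x : iobj F n) : n <= k ->
  exists y : iobj F k, forall (Y : Sets) (c : forall n, iobj F n -> Y),
    (forall n, c n.+1 \o @iconn F n =1 c n) -> c n x = c k y.
Proof.
elim: k => [|k IH]; first by rewrite leqn0 => /eqP n0; subst n; exists x.
rewrite leq_eqVlt => /orP[/eqP nk|/IH[y xy]]; first by subst n; exists x.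
by exists (iconn y) => Y c cP; rewrite (xy _ _ cP) -cP.
Qed.

Lemma trunc_ubar n k x : n <= k -> eps k (ubar (@w n x)) = ubar (@w n x).
Proof.
move=> /(iobj_lift x)[y ->] //.
by rewrite /trunc /trunc_emb /= proj_ubar Fpoint_bang [@w k.+1 _]w_cocone.
Qed.

Lemma truncM n k x : eps n (eps k x) = eps (minn n k) x.
Proof.
have [nk|kn] := leqP n k.
  by apply: trunc_proj; apply: tproj_eq nk _; apply: proj_trunc.
(* [eps k x] comes from stage [k.+1] of the initial chain, and [k < n] is exactly [k.+1 <= n]. *)
exact: trunc_ubar.
Qed.

Lemma trunc_inj x y : (forall n, eps n x = eps n y) -> x = y.
Proof. by move=> xy; apply: tproj_inj => n; rewrite -proj_trunc xy proj_trunc. Qed.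

Lemma trunc_lim (y : nat -> T oomega) :
  (forall n k, n <= k -> eps n (y k) = eps n (y n)) ->
  exists s, forall n, eps n s = eps n (y n).
Proof.
move=> y_comp; have [n k nk|s sy] := @tproj_lim F W T y.
  by rewrite -proj_trunc y_comp // proj_trunc.
by exists s => n; apply: trunc_proj.
Qed.

Section InitialAlgebra.
Variables (delta : W) (wdelta : ole oomega delta) (tau : T delta -> F (T delta)).
Hypothesis tauK : cancel tau (@tconn F W T delta).
Variables (mu : Sets) (iota : F mu -> mu) (iotaV : mu -> F mu).
Hypothesis iotaK : cancel iota iotaV.
Variable m : mu -> T delta.
Hypothesis mP : coalgebra_hom iotaV tau m.

Lemma coalgebra_hom_alg : m \o iota =1 @tconn F W T delta \o fmap F m.
Proof. by move=> z /=; rewrite -[LHS]tauK [tau _]mP /= iotaK. Qed.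

Fixpoint mu_cocone n : iobj F n -> mu :=
  if n is n'.+1 then iota \o fmap F (@mu_cocone n') else of_void mu.

Lemma mu_coconeP n : @mu_cocone n.+1 \o @iconn F n =1 @mu_cocone n.
Proof.
elim: n => [[]|n IH] x /=; rewrite -fmapD; congr iota; apply: eq_fmap => y.
exact: IH.
Qed.

Lemma proj_mu_cocone n x : proj n (tmap T wdelta (m (mu_cocone x))) = bang n x.
Proof.
have hn k : ole (ofin k) delta := ole_trans (ole_fin_omega W k) wdelta.
rewrite [proj n _](tmapD _ _ (hn n)); elim: n x => [[]|n IH] x /=.
have /= -> := coalgebra_hom_alg (fmap F (@mu_cocone n) x).
have hs := ole_succ2 (hn n).
have /= sE z := tmap_succ (hn n) hs z.
rewrite (tmapD _ _ hs) sE -!fmapD; congr (tsucc T _ _).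
by apply: eq_fmap => y; apply: IH.
Qed.

Lemma ubar_mu_cocone n x : tmap T wdelta (m (mu_cocone x)) = ubar (@w n x).
Proof.
apply: tproj_inj => k.
(* The projections of a point from a given stage are known only up to that level, so [x] is first
   moved to a stage at least [k]. *)
have [y xy] := iobj_lift x (leq_maxl n k).
rewrite (xy _ _ mu_coconeP) (xy _ _ w_cocone).
by apply: tproj_eq (leq_maxr n k) _; rewrite proj_mu_cocone proj_ubar.
Qed.

Lemma mu_dense n c : exists a, tmap T wdelta (m a) = eps n c.
Proof. by exists (mu_cocone (point n (proj n c))); rewrite ubar_mu_cocone. Qed.
End InitialAlgebra.
End CanonicalOrder.

Theorem theorem5p5 (F : set_functor) (F_precont : precontinuous F)
    (* the terminal-coalgebra chain *)
    (W : ordinals) (T : terminal_chain F W)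
    (* F^omega 0, its colimit cocone, and the comparison map *)
    (F0 : Sets) (w : forall n, iobj F n -> F0) (wP : initial_omega w)
    (ubar : F0 -> T oomega)
    (ubarP : forall n, @tproj F W T n \o ubar \o w n =1 @Fbang F W T n)
    (* nu F = F^delta 1 and tau, the inverse of v_(delta+1,delta) *)
    (delta : W) (deltaP : convergence_ordinal T delta)
    (omega_le_delta : ole oomega delta)
    (tau : T delta -> F (T delta))
    (tconnK : cancel (@tconn F W T delta) tau)
    (tauK : cancel tau (@tconn F W T delta))
    (* the initial algebra, the inverse of its structure, and m *)
    (mu : Sets) (iota : F mu -> mu) (iotaP : initial_algebra iota)
    (iotaV : mu -> F mu) (iotaK : cancel iota iotaV) (iotaVK : cancel iotaV iota)
    (m : mu -> T delta) (mP : coalgebra_hom iotaV tau m)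
    (* a choice of p : 1 -> F 0; in particular F 0 is nonempty *)
    (p : F void) :
  let le_nu : relation (T delta) :=
    pull_order (tmap T omega_le_delta) (le_omega w ubar p) in
  let le_mu : relation mu := pull_order m le_nu in
  let le_Fnu : relation (F (T delta)) := pull_order (@tconn F W T delta) le_nu in
  (exists (C : Sets) (leC : relation C) (j_mu : mu -> C) (j_nu : T delta -> C),
     [/\ ideal_completion le_mu leC j_mu,
         ideal_completion le_nu leC j_nu
       & j_nu \o m =1 j_mu])
  /\ unique (fun f : T delta -> F (T delta) =>
               continuous le_nu le_Fnu f /\ f \o m =1 fmap F m \o iotaV)
       tau.
Proof.
move=> le_nu le_mu le_Fnu; have w_cocone := wP.1.
pose eps := trunc w ubar p; pose v := tmap T omega_le_delta.
have epsM n k x : eps n (eps k x) = eps (minn n k) x by exact: truncM.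
have eps_inj x y : (forall n, eps n x = eps n y) -> x = y by exact: trunc_inj.
have eps_lim y : (forall n k, n <= k -> eps n (y k) = eps n (y n)) ->
    exists s, forall n, eps n s = eps n (y n) by exact: trunc_lim.
have m_dense n c : exists a, v (m a) = eps n c by exact: mu_dense.
have v_dense n c : exists a, v a = eps n c.
  by have [a va] := m_dense n c; exists (m a).
have v_inj : injective v.
  apply: tmap_inj F_precont _ _ _.
  (* Injectivity needs a nonempty stage, and [p] supplies a point of [mu]. *)
  exact: inhabits (m (iota (fmap F (of_void mu) p))).
have m_inj : injective m.
  have m_alg := coalgebra_hom_alg tauK iotaK mP.
  exact: initial_algebra_hom_inj iotaP (can_inj tconnK) m_alg.
have nu_order : Relation_Definitions.order _ le_nu by exact: pull_trunc_order.
have Fnu_anti : Relation_Definitions.antisymmetric _ le_Fnu.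
  move=> x y xy yx; apply: (can_inj tconnK); exact: (ord_antisym _ _ nu_order).
have tau_cont : continuous le_nu le_Fnu tau.
  (* [le_Fnu] is pulled back along the inverse of [tau], so [tau] is an order isomorphism. *)
  move=> D s _ [ub lub]; split=> [_ [x Dx <-]|u u_ub].
    by rewrite /le_Fnu /pull_order !tauK; apply: ub.
  rewrite /le_Fnu /pull_order tauK; apply: lub => x Dx.
  by rewrite -[x]tauK; apply: u_ub; exists x.
split.
  (* [le_mu] and [le_nu] unfold to the pullbacks of [trunc_le eps] along [v \o m] and [v]. *)
  exists (T oomega), (trunc_le eps), (v \o m), v.
  split=> //; apply: trunc_completion => //; exact: inj_comp.
split=> [|f [f_cont fm]]; first by split=> // x; apply: mP.
apply: (dense_continuous_eq epsM eps_inj v_inj v_dense m_dense Fnu_anti) => //.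
by move=> x; rewrite [RHS]fm; apply: mP.
Qed.
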